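(* There are infinitely many irreducible cubic polynomials $f\in \mathbb{Z}[x]$ with emergent reducibility at depth $1$ (over $\mathbb{Q}$); that is, there are infinitely many cubics $f \in \mathbb{Z}[x]$ such that $f$ is irreducible over $\mathbb{Q}$ but $f\circ f$ is reducible over $\mathbb{Q}$.
   Context: For a field $K$ and $f\in K[x]$, write $f^{\circ 0}=f$ and $f^{\circ k}=f\circ f^{\circ (k-1)}$, so $f^{\circ k}$ is $f$ composed with itself $k$ additional times ($f^{\circ 1}=f\circ f$). The polynomial $f$ has emergent reducibility at depth $n$ over $K$ if $f^{\circ i}$ is irreducible over $K$ for $0\le i\le n-1$ and $f^{\circ n}$ is reducible over $K$. Here $K=\mathbb{Q}$. *)

(* Defs.v *)
From mathcomp Require Import all_boot all_order all_algebra.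
Set Implicit Arguments.
Unset Strict Implicit.
Unset Printing Implicit Defensive.
Import GRing.Theory.
Local Open Scope ring_scope.

(* Indexing convention: [compn f 0] is [f] itself, not ['X], so [compn f k]
   is [f] composed with itself [k] additional times. *)
Fixpoint compn (K : fieldType) (f : {poly K}) (k : nat) : {poly K} :=
  if k is k'.+1 then f \Po compn f k' else f.

Definition reducible_poly (K : fieldType) (p : {poly K}) : Prop :=
  exists g h : {poly K}, [/\ (1 < size g)%N, (1 < size h)%N & p = g * h].

Definition emergent_reducibility (K : fieldType) (n : nat) (f : {poly K}) : Prop :=
  (forall i : nat, (i < n)%N -> irreducible_poly (compn f i)) /\
  reducible_poly (compn f n).

(* Main.v *)
Require Import Defs.
From mathcomp Require Import all_boot all_order all_algebra.
From mathcomp Require Import classical_sets cardinality.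
From mathcomp Require Import ring zify.
Import GRing.Theory Num.Theory.
Local Open Scope ring_scope.
Local Open Scope classical_set_scope.

(** If [f (L x) = c (f x - L x)] for some linear [L] and constant [c], then [f - L]
divides both [f \o f - f \o L] and [f \o L], hence also [f \o f]. With
[L = 1 - 2 x] and [c = -8] the cubic solutions over Q are
[8 x (2 x - 1)^2 + k (3 x - 1)^3]. For [k = 1 mod 5] such a cubic has no root
over Q because the associated binary form is anisotropic over F_5. *)

(** The ring stays arbitrary because the same formula is used over [int] and, through [map_cubic],
    over [rat]. *)
Definition cubic {R : comNzRingType} (k : R) : {poly R} :=
  8 * 'X * (2 * 'X - 1) ^+ 2 + k%:P * (3 * 'X - 1) ^+ 3.

Lemma map_cubic {R S : comNzRingType} (f : {rmorphism R -> S}) (k : R) :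
  map_poly f (cubic k) = cubic (f k).
Proof.
by rewrite /cubic !(rmorphD, rmorphN, rmorphM, rmorphXn, rmorph1, rmorph_nat) /=
   !map_polyX map_polyC.
Qed.

Lemma comp_cubic {R : comNzRingType} (k : R) (p : {poly R}) :
  cubic k \Po p = 8 * p * (2 * p - 1) ^+ 2 + k%:P * (3 * p - 1) ^+ 3.
Proof.
by rewrite /cubic !(rmorphD, rmorphN, rmorphM, rmorphXn, rmorph1, rmorph_nat) /=
   !comp_polyX comp_polyC.
Qed.

Lemma horner_cubic {R : comNzRingType} (k x : R) :
  (cubic k).[x] = 8 * x * (2 * x - 1) ^+ 2 + k * (3 * x - 1) ^+ 3.
Proof.
rewrite /cubic.
by rewrite !(hornerMn, hornerM, horner_exp, hornerN, hornerX, hornerC, hornerD).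
Qed.

Lemma size_cubic (R : comNzRingType) (k : R) :
  32 + 27 * k != 0 -> size (cubic k) = 4.
Proof.
move=> lead_neq0.
have -> : cubic k = Poly [:: - k; 8 + 9 * k; - (32 + 27 * k); 32 + 27 * k].
  rewrite /= !cons_poly_def /cubic.
  by rewrite !(polyCD, polyCN, polyCM, polyC_natr); ring.
by rewrite (@PolyK _ 0).
Qed.

(* [(cubic k - L) * Q - 8 * (cubic k - L)], where [L = 1 - 2 'X] and
   [cubic k \Po cubic k - cubic k \Po L = (cubic k - L) * Q]. *)
Lemma comp_cubic_factor {R : comNzRingType} (k : R) :
  cubic k \Po cubic k =
  (cubic k - (1 - 2 * 'X)) *
    ((32 + 27 * k)%:P *
      (cubic k ^+ 2 + cubic k * (1 - 2 * 'X) + (1 - 2 * 'X) ^+ 2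
        - (cubic k + (1 - 2 * 'X)))
      + (9 * k)%:P).
Proof.
rewrite comp_cubic !(polyCD, polyCM, polyC_natr) /cubic; ring.
Qed.

(** This is the homogenization of [cubic 1]; anisotropy is checked by computation on all 25
    pairs. *)
Lemma form_F5_anisotropic (x y : 'F_5) :
  8 * x * (2 * x - y) ^+ 2 + (3 * x - y) ^+ 3 == 0 -> (x == 0) && (y == 0).
Proof.
by case: x y => [[|[|[|[|[|x]]]]] ltx] [[|[|[|[|[|y]]]]] lty].
Qed.

(** The composite has degree 9 and the first factor of [comp_cubic_factor] has degree 3, which
    leaves degree 6 for the other. *)
Lemma reducible_comp_cubic (R : fieldType) (k : R) :
  32 + 27 * k != 0 -> reducible_poly (cubic k \Po cubic k).
Proof.
move=> lead_neq0; have szf := size_cubic _ _ lead_neq0.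
have szff : size (cubic k \Po cubic k) = 10.
  have := size_comp_poly (cubic k) (cubic k); rewrite szf /=.
  by case: (size _) => [|n] //= ->.
rewrite comp_cubic_factor in szff *.
set g := cubic k - _ in szff *; set h := (X in g * X) in szff *.
have szg : size g = 4.
  (* The size of [1 - 2 'X] is only bounded by 2, since [2] may vanish in [R]. *)
  rewrite /g size_polyDl // szf size_polyN.
  rewrite -polyC_natr mulrC -polyC1.
  apply: leq_ltn_trans (size_polyD _ _) _; rewrite gtn_max size_polyC oner_eq0.
  rewrite size_polyN mulrC mul_polyC.
  by apply: leq_ltn_trans (size_scale_leq _ _) _; rewrite size_polyX.
have [g0 h0] : g != 0 /\ h != 0.
  by apply/andP; rewrite -negb_or -mulf_eq0 -size_poly_eq0 szff.
exists g, h; split=> //; first by rewrite szg.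
by move: szff; rewrite size_mul // szg; case: (size h) => [|[]].
Qed.

(** For a root [n / d] in lowest terms, clearing denominators by [d ^+ 3] gives an integral zero of
    the binary form; modulo 5, anisotropy forces 5 to divide both [n] and [d]. *)
Lemma cubic_no_rat_root (k : int) (x : rat) :
  (k%:~R = 1 :> 'F_5) -> ~~ root (cubic (k%:~R : rat)) x.
Proof.
move=> k1; apply/negP; rewrite rootE horner_cubic -[x]divq_num_den.
have := coprime_num_den x; have := denq_neq0 x.
move: (numq x) (denq x) => n d d0 cop /eqP root0.
have dQ : d%:~R != 0 :> rat by rewrite intr_eq0.
have : 8 * n * (2 * n - d) ^+ 2 + k * (3 * n - d) ^+ 3 = 0.
  apply: (@intr_inj rat).
  rewrite !(rmorphD, rmorphN, rmorphM, rmorphXn, rmorph1, rmorph_nat) /=.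
  rewrite -[RHS](mulr0 (d%:~R ^+ 3)) -root0.
  by field.
move/(congr1 (intr : int -> 'F_5)).
rewrite !(rmorphD, rmorphN, rmorphM, rmorphXn, rmorph1, rmorph_nat) /= k1 mul1r.
move/eqP/form_F5_anisotropic; rewrite -!(dvdz_pcharf (pchar_Fp (isT : prime 5))) => /andP[n5 d5].
have : (5 %| gcdn `|n| `|d|)%N by rewrite dvdn_gcd; apply/andP; split.
by rewrite (eqP cop).
Qed.

Lemma lead_cubic_neq0 (k : int) : 32 + 27 * k%:~R != 0 :> rat.
Proof.
have -> : 32 + 27 * k%:~R = (32 + 27 * k)%:~R :> rat.
  by rewrite rmorphD rmorphM.
(* An integer [k] cannot cancel the sum because 27 does not divide 32. *)
by rewrite intr_eq0; lia.
Qed.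

Lemma cubic_irreducible_rat (k : int) :
  (k%:~R = 1 :> 'F_5) -> irreducible_poly (cubic (k%:~R : rat)).
Proof.
move=> k1; apply: cubic_irreducible => [|x]; last exact: cubic_no_rat_root.
by rewrite size_cubic // lead_cubic_neq0.
Qed.

Theorem theorem1p1 :
  infinite_set [set f : {poly int} |
    [/\ size f = 4%N,
        irreducible_poly (map_poly (intr : int -> rat) f) &
        emergent_reducibility 1 (map_poly (intr : int -> rat) f)]].
Proof.
pose f (m : nat) : {poly int} := cubic (5 * m%:Z + 1).
have f_inj : injective f.
  (* The value of [f m] at 0 is [- (5 * m + 1)], which determines [m]. *)
  move=> m n /(congr1 (horner^~ 0)); rewrite !horner_cubic; lia.
have : infinite_set (range f).
  rewrite /not (eq_finite_set (inj_card_eq (in2W f_inj))); exact: infinite_nat.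
apply: sub_infinite_set => _ [m _ <-] /=.
have irr : irreducible_poly (map_poly (intr : int -> rat) (f m)).
  rewrite map_cubic; apply: cubic_irreducible_rat.
  by rewrite rmorphD rmorphM rmorph_nat (pchar_Fp_0 (isT : prime 5)) mul0r add0r.
split=> //; first by apply: size_cubic; lia.
(* At depth 1 the only iterate required to be irreducible is [compn _ 0], the cubic itself. *)
split; first by case.
by rewrite /= map_cubic; apply: reducible_comp_cubic; exact: lead_cubic_neq0.
Qed.
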